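(* There exist a $(1576,8,1)$-RBIBD and a $(2976,8,1)$-RBIBD.
   Context: A $(v,k,\lambda)$-BIBD is a pair $(V,\mathcal{A})$ where $V$ is a set of $v$ points and $\mathcal{A}$ is a collection of $k$-subsets of $V$ (blocks) such that every $2$-subset of $V$ is contained in exactly $\lambda$ blocks of $\mathcal{A}$. It is resolvable (a $(v,k,\lambda)$-RBIBD) if there exists a partition of $\mathcal{A}$ (a resolution) into parallel classes, each of which is a partition of $V$. *)

(* Defs.v *)
From mathcomp Require Import all_boot.

Set Implicit Arguments.
Unset Strict Implicit.
Unset Printing Implicit Defensive.

(* The collection of blocks is a sequence considered up to permutation, i.e.
   a multiset: for lambda > 1 a block may be repeated, and [count] counts it
   with multiplicity. *)
Definition is_BIBD (v k lambda : nat) (V : finType) (A : seq {set V}) : Prop :=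
  [/\ #|V| = v,
      forall B : {set V}, B \in A -> #|B| = k
    & forall P : {set V}, #|P| = 2 ->
        count (fun B : {set V} => P \subset B) A = lambda].

(* [uniq] is needed because [set B in C] forgets multiplicities. *)
Definition parallel_class (V : finType) (C : seq {set V}) : bool :=
  uniq C && partition [set B in C] [set: V].

Definition resolution (V : finType) (A : seq {set V})
    (R : seq (seq {set V})) : Prop :=
  perm_eq (flatten R) A /\
  (forall C : seq {set V}, C \in R -> parallel_class C).

Definition is_RBIBD (v k lambda : nat) (V : finType) (A : seq {set V}) : Prop :=
  is_BIBD v k lambda A /\
  (exists R : seq (seq {set V}), resolution A R).

(* Main.v *)
(* A frame difference family over H x K, relative to H x {0}, is a list of base
   blocks whose differences are the elements (h, d) with d <> 0, collected in
   bundles such that the second coordinates of each bundle run through K \ {0}. The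
   H-translates of a bundle then partition H x (K \ {0}). A parallel class of a
   resolvable design on H and a point at infinity, placed on H x {0}, completes them
   to a parallel class, and the K-translates of the classes so obtained form a
   resolvable design on H x K and infinity. Here K = F_25, and the design on H and
   infinity is AG(2,8), with |H| = 63, or the design of order 120 carried by a
   Denniston arc in AG(2,16), with |H| = 119. The frame difference families were
   found by computer, as unions of orbits of a group acting regularly on F_25 \ {0}. *)
Require Import Defs.
From HB Require Import structures.
From mathcomp Require Import all_boot all_algebra.

Set Implicit Arguments.
Unset Strict Implicit.
Unset Printing Implicit Defensive.

(* Equips products of finite abelian groups with their finZmodType structure. *)
HB.saturate prod.

Import GRing.Theory.

(** * Covers by parallel classes, and the counting that makes them designs *)

(** Blocks are lists and coverage means at least once, so every condition is met by exhibiting a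
    block; the prescribed sizes then force exactly once. *)
Definition resolved_cover (k : nat) (V : finType) (R : seq (seq (seq V))) : Prop :=
  [/\ size R * k.-1 = #|V|.-1,
      forall C, C \in R -> size C * k = #|V|,
      forall C B, C \in R -> B \in C -> size B = k,
      forall C x, C \in R -> exists2 B, B \in C & x \in B
    & forall x y, x != y ->
        exists C B, [/\ C \in R, B \in C, x \in B & y \in B]].

Arguments resolved_cover : clear implicits.

(** Blocks of at most [k] points, [size s] in number, must cover [size s * k] points, which leaves
    no room for repeated, short or overlapping blocks. *)
Lemma parallel_class_of_cover (V : finType) (k : nat) (s : seq {set V}) :
    0 < k -> size s * k = #|V| ->
    (forall B, B \in s -> #|B| <= k) ->
    (forall x, exists2 B, B \in s & x \in B) ->
  parallel_class s /\ forall B, B \in s -> #|B| = k.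
Proof.
move=> k_gt0 size_s le_k cov_s; set P := [set B in s].
have cardP : #|P| <= size s by rewrite cardsE card_size.
have coverP : cover P = [set: V].
  apply/setP=> x; rewrite inE; have [B sB Bx] := cov_s x.
  by apply/bigcupP; exists B; rewrite ?inE.
have le_sum : \sum_(B in P) #|B| <= \sum_(B in P) k.
  by apply: leq_sum => B; rewrite inE => /le_k.
have leVsum : #|V| <= \sum_(B in P) #|B|.
  by rewrite -cardsT -coverP; apply: leq_card_cover.
have sum_le : \sum_(B in P) k <= #|V|.
  by rewrite sum_nat_const -size_s leq_mul2r cardP orbT.
have eqP_size : #|P| = size s.
  apply/eqP; rewrite eqn_leq cardP -(leq_pmul2r k_gt0) size_s -sum_nat_const.
  exact: leq_trans leVsum le_sum.
have card_k B : B \in s -> #|B| = k.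
  move=> sB; have PB : B \in P by rewrite inE.
  (* The sums of [#|B|] and of [k] agree, so each termwise bound is an equality. *)
  have [_ ] := @leqif_sum _ [in P] (fun B => #|B| == k) (fun B => #|B|) (fun=> k)
    (fun B PB => leqif_eq (le_k B (ltac:(by rewrite inE in PB)))).
  rewrite eqn_leq le_sum (leq_trans sum_le leVsum) => /esym/forall_inP.
  by move=> /(_ B PB)/eqP.
split=> //; apply/andP; split.
  by apply/card_uniqP; rewrite -eqP_size cardsE.
rewrite /partition coverP eqxx /=; apply/andP; split.
  rewrite /trivIset coverP cardsT eqn_leq leVsum.
  by rewrite (leq_trans le_sum sum_le).
by apply/negP; rewrite inE => /card_k; rewrite cards0 => k0; rewrite -k0 in k_gt0.
Qed.

Lemma sum_count_pairs (V : finType) (k : nat) (A : seq {set V}) :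
    (forall B, B \in A -> #|B| = k) ->
  \sum_(P : {set V} | #|P| == 2) count (fun B : {set V} => P \subset B) A
    = size A * 'C(k, 2).
Proof.
elim: A => [_|B A IHA Ak] /=; first by rewrite big1.
rewrite big_split /= IHA => [|D AD]; last by apply: Ak; rewrite inE AD orbT.
rewrite mulSn; congr (_ + _); rewrite -(Ak B (mem_head _ _)) -(cards_draws B 2).
by rewrite -big_mkcondr sum1dep_card; apply: eq_card => P; rewrite !inE andbC.
Qed.

(* Each pair lies in some block, and the blocks contain size A * 'C(k, 2) =
   'C(#|V|, 2) pairs in all, so each pair lies in exactly one. *)
Lemma RBIBD_of_resolved_cover (k : nat) (V : finType) R :
    1 < k -> resolved_cover k V R ->
  exists A : seq {set V}, is_RBIBD #|V| k 1 A.
Proof.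
move=> k_gt1 [size_R size_C size_B cov_C cov_pair].
have k_gt0 := ltnW k_gt1.
pose to_set (B : seq V) := [set x in B].
pose R' := map (map to_set) R; pose A := flatten R'.
have classP s : s \in R' -> size s * k = #|V| /\
    (parallel_class s /\ forall B, B \in s -> #|B| = k).
  case/mapP=> C RC ->; have sC : size (map to_set C) * k = #|V|.
    by rewrite size_map size_C.
  split=> //; apply: parallel_class_of_cover => // [B /mapP[b Cb ->]|x].
    by rewrite cardsE (leq_trans (card_size _)) // (size_B C).
  by have [B CB Bx] := cov_C C x RC; exists (to_set B); rewrite ?map_f ?inE.
have card_k B : B \in A -> #|B| = k.
  by case/flattenP=> s /classP[_ [_ +]]; apply.
have size_A : size A * k = size R * #|V|.
  have -> : size R = size R' by rewrite size_map.
  rewrite /A; elim: (R') classP => //= s S IHS sP.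
  rewrite size_cat mulnDl IHS => [|t St]; last by apply: sP; rewrite inE St orbT.
  by have [-> _] := sP s (mem_head _ _).
exists A; split; last first.
  exists R'; split=> // s /classP[_ []]//.
split=> // P /eqP cardP.
have leif (Q : {set V}) : #|Q| == 2 ->
    1 <= count (fun B : {set V} => Q \subset B) A
      ?= iff (1 == count (fun B : {set V} => Q \subset B) A).
  move=> /cards2P[x [y [nxy ->]]]; apply: leqif_eq.
  have [C [B [RC CB Bx By]]] := cov_pair x y nxy.
  rewrite -has_count; apply/hasP; exists (to_set B).
    by apply/flattenP; exists (map to_set C); rewrite !map_f.
  by apply/subsetP=> z; rewrite !inE => /orP[]/eqP->.
have [_ ] := leqif_sum leif.
rewrite (sum_count_pairs card_k) sum1dep_card card_draws => /esym eq_all.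
suff eqA : 'C(#|V|, 2) = size A * 'C(k, 2).
  by move: eq_all; rewrite eqA eqxx => /forall_inP/(_ P cardP)/eqP/esym.
(* After doubling, both sides are [v * (v - 1)], since [size A * k = size R * v] and
   [size R * (k - 1) = v - 1]. *)
apply/eqP; rewrite -(eqn_pmul2r (isT : 0 < 2)) -mulnA.
have bin2M n : 'C(n, 2) * 2 = n * n.-1.
  by rewrite muln2 bin2 -[RHS]odd_double_half oddM; case: n => //= n; rewrite andNb.
by rewrite !bin2M mulnA size_A mulnAC size_R mulnC.
Qed.

(** Lets a design on ['Z_7 * 'Z_9] and infinity fill a hole over ['Z_7 * ('Z_3 * 'Z_3)]. *)
Lemma resolved_cover_transport (k : nat) (V W : finType) R :
  #|V| = #|W| -> resolved_cover k V R -> exists R', resolved_cover k W R'.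
Proof.
move=> eqVW [size_R size_C size_B cov_C cov_pair].
pose f x := enum_val (cast_ord eqVW (enum_rank x)).
pose g y := enum_val (cast_ord (esym eqVW) (enum_rank y)).
have gK : cancel g f by move=> y; rewrite /f /g enum_valK cast_ordKV enum_rankK.
exists (map (map (map f)) R); split.
- by rewrite size_map size_R eqVW.
- by move=> _ /mapP[C RC ->]; rewrite size_map size_C.
- by move=> _ _ /mapP[C RC ->] /mapP[B CB ->]; rewrite size_map (size_B C).
- move=> _ y /mapP[C RC ->]; have [B CB By] := cov_C C (g y) RC.
  by exists (map f B); [exact: map_f|rewrite -(gK y) map_f].
move=> x y nxy; have [|C [B [RC CB Bx By]]] := cov_pair (g x) (g y).
  by rewrite (can_eq gK).
exists (map (map f) C), (map f B); rewrite -(gK x) -(gK y).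
by split; apply: map_f.
Qed.

Local Open Scope ring_scope.

(** * Development over a group, with infinity fixed *)

Definition shift (A : Type) (K : zmodType) (x : K) : option (A * K) -> option (A * K) :=
  omap (fun p => (p.1, p.2 + x)).

Lemma card_option_prod (A B : finType) : #|{: option (A * B)}| = (#|A| * #|B|).+1.
Proof. by rewrite card_option card_prod. Qed.

(** Bose's method of mixed differences: a base block through [(a, x)] and [(b, x + (z - y))],
    translated by [y - x], passes through [(a, y)] and [(b, z)]. *)
Lemma resolved_cover_develop (k : nat) (A : finType) (K : finZmodType)
    (Cs : seq (seq (seq (option (A * K))))) :
    (size Cs * k.-1)%N = #|A| ->
    (forall C, C \in Cs -> (size C * k)%N = (#|A| * #|K|).+1) ->
    (forall C B, C \in Cs -> B \in C -> size B = k) ->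
    (forall C x, C \in Cs -> exists2 B, B \in C & x \in B) ->
    (forall a, exists C B x,
       [/\ C \in Cs, B \in C, None \in B & Some (a, x) \in B]) ->
    (forall a b d, (a, 0) != (b, d) -> exists C B x,
       [/\ C \in Cs, B \in C, Some (a, x) \in B & Some (b, x + d) \in B]) ->
  resolved_cover k (option (A * K))
    [seq [seq [seq shift x p | p <- B] | B <- C] | C <- Cs, x <- enum K].
Proof.
move=> size_Cs size_C size_B cov_C cov_inf cov_pair.
have shiftNK (x : K) (p : option (A * K)) : shift x (shift (- x) p) = p.
  by case: p => //= -[a y]; rewrite /= addrNK.
have dev C (B : seq (option (A * K))) x y z :
    C \in Cs -> B \in C -> shift (- x) y \in B -> shift (- x) z \in B ->
  exists C' B', [/\ C' \in [seq [seq [seq shift x p | p <- B] | B <- C]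
      | C <- Cs, x <- enum K], B' \in C', y \in B' & z \in B'].
  move=> CC CB By Bz; exists [seq [seq shift x p | p <- B] | B <- C].
  exists [seq shift x p | p <- B]; split.
  - by apply/allpairsP; exists (C, x); rewrite mem_enum.
  - exact: (map_f (fun B => [seq shift x p | p <- B])).
  - by rewrite -(shiftNK x y) map_f.
  - by rewrite -(shiftNK x z) map_f.
split.
- by rewrite size_allpairs -cardE card_option_prod /= mulnAC size_Cs.
- by move=> _ /allpairsP[[C x] [/= CC _ ->]]; rewrite size_map card_option_prod size_C.
- move=> _ _ /allpairsP[[C x] [/= CC _ ->]] /mapP[B CB ->].
  by rewrite size_map (size_B C).
- move=> _ y /allpairsP[[C x] [/= CC _ ->]].
  have [B CB By] := cov_C C (shift (- x) y) CC.
  exists [seq shift x p | p <- B]; last by rewrite -(shiftNK x y) map_f.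
  exact: (map_f (fun B => [seq shift x p | p <- B])).
have cov_none a y : exists C' B', [/\ C' \in [seq [seq [seq shift x p | p <- B]
    | B <- C] | C <- Cs, x <- enum K], B' \in C', None \in B' & Some (a, y) \in B'].
  have [C [B [x [CC CB B0 Bx]]]] := cov_inf a.
  by apply: (dev C B (y - x)) => //=; rewrite opprB addrC subrK.
case=> [[a y]|]; last by case=> // -[b z] _; apply: cov_none.
case=> [[b z]|] nyz; last by have [C [B [? ? ? ?]]] := cov_none a y; exists C, B.
have [|C [B [x [CC CB Ba Bb]]]] := cov_pair a b (z - y).
  by apply: contra nyz => /eqP[-> /esym/eqP]; rewrite subr_eq0 => /eqP->.
apply: (dev C B (y - x)) => //=; first by rewrite opprB addrC subrK.
by rewrite opprB addrCA.
Qed.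

(** * Frame difference families and filling the hole *)

(** The sizes make the existence conditions exact: a bundle has [#|K| - 1] entries, and all blocks
    together have [#|H| * (#|K| - 1)] differences. *)
Definition frame_difference_family (k : nat) (H K : finZmodType)
    (F : seq (seq (seq (H * K)))) : Prop :=
  [/\ (size F * k.-1)%N = #|H|,
      forall C, C \in F -> (size C * k)%N = #|K|.-1,
      forall C B, C \in F -> B \in C -> size B = k,
      forall C d, C \in F -> d != 0 -> exists B h, B \in C /\ (h, d) \in B
    & forall h d, d != 0 -> exists C B p,
        [/\ C \in F, B \in C, p \in B & p + (h, d) \in B]].

Lemma mem_zip_unzip1 (S T : eqType) (s : seq S) (t : seq T) x :
  size s = size t -> x \in s -> exists y, (x, y) \in zip s t.
Proof.
elim: s t => [|a s IHs] [|b t] //= [eq_st]; rewrite inE => /predU1P[->|].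
  by exists b; rewrite mem_head.
by move=> /(IHs _ eq_st)[y xy]; exists y; rewrite inE xy orbT.
Qed.

Lemma mem_zip_unzip2 (S T : eqType) (s : seq S) (t : seq T) y :
  size s = size t -> y \in t -> exists x, (x, y) \in zip s t.
Proof.
elim: s t => [|a s IHs] [|b t] //= [eq_st]; rewrite inE => /predU1P[->|].
  by exists a; rewrite mem_head.
by move=> /(IHs _ eq_st)[x xy]; exists x; rewrite inE xy orbT.
Qed.

Lemma mem_zip (S T : eqType) (s : seq S) (t : seq T) x y :
  (x, y) \in zip s t -> x \in s /\ y \in t.
Proof.
elim: s t => [|a s IHs] [|b t] //=; rewrite !inE => /predU1P[[-> ->]|/IHs[-> ->]].
  by rewrite !eqxx.
by rewrite !orbT.
Qed.

Lemma resolved_cover_fill (k : nat) (H K : finZmodType)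
    (F : seq (seq (seq (H * K)))) R0 :
    (1 < k)%N -> frame_difference_family k F ->
    resolved_cover k (option H) R0 ->
  exists R, resolved_cover k (option (H * K)) R.
Proof.
move=> k_gt1 [size_F size_C size_B cov_C cov_pair] [].
rewrite card_option /= => size_R0 size_C0 size_B0 cov_C0 cov_pair0.
(* Both numbers are [#|H| / (k - 1)], so [zip] matches each bundle with one class of the hole. *)
have eq_size : size R0 = size F.
  apply/eqP; rewrite -(eqn_pmul2r (_ : 0 < k.-1)%N) ?size_R0 ?size_F //.
  by rewrite -subn1 subn_gt0.
pose trans (h : H) (p : H * K) : option (H * K) := Some (p.1 + h, p.2).
pose hole : option H -> option (H * K) := omap (fun h => (h, 0)).
pose frame C := [seq [seq trans h p | p <- B] | h <- enum H, B <- C].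
pose cls Z := frame Z.2 ++ [seq [seq hole p | p <- B] | B <- Z.1].
have frameI C (B : seq (H * K)) h : B \in C -> [seq trans h p | p <- B] \in frame C.
  by move=> CB; apply/allpairsP; exists (h, B); rewrite mem_enum.
have holeI C (B : seq (option H)) :
    B \in C -> [seq hole p | p <- B] \in [seq [seq hole p | p <- B] | B <- C].
  by move=> CB; apply: (map_f (fun B => [seq hole p | p <- B])).
have frame_mem (B : seq (H * K)) h d h0 :
    (h0, d) \in B -> Some (h, d) \in [seq trans (h - h0) p | p <- B].
  by move=> Bd; apply/mapP; exists (h0, d) => //; rewrite /trans /= addrCA subrr addr0.
exists [seq [seq [seq shift x p | p <- B] | B <- C]
  | C <- map cls (zip R0 F), x <- enum K].
apply: resolved_cover_develop.
- by rewrite size_map size1_zip ?eq_size.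
- move=> _ /mapP[[C0 C] /mem_zip[/= RC0 FC] ->].
  rewrite size_cat size_allpairs size_map -cardE mulnDl -mulnA size_C // size_C0 //.
  (* [#|H| * (#|K| - 1)] frame points and [#|H| + 1] hole points make [#|H| * #|K| + 1]. *)
  rewrite addnS -mulnSr prednK //.
  by apply/card_gt0P; exists 0.
- move=> _ B /mapP[[C0 C] /mem_zip[/= RC0 FC] ->].
  rewrite mem_cat => /orP[/allpairsP[[h D] [/= _ CD ->]]|/mapP[D CD ->]].
    by rewrite size_map (size_B C).
  by rewrite size_map (size_B0 C0).
- move=> _ y /mapP[[C0 C] /mem_zip[/= RC0 FC] ->].
  have in_hole z : exists2 B, B \in cls (C0, C) & hole z \in B.
    have [B CB Bz] := cov_C0 C0 z RC0.
    exists [seq hole p | p <- B]; last exact: map_f.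
    by rewrite mem_cat holeI ?orbT.
  case: y => [[h d]|]; last exact: (in_hole None).
  have [->|nd] := eqVneq d 0; first exact: (in_hole (Some h)).
  have [B [h0 [CB Bd]]] := cov_C C d FC nd.
  exists [seq trans (h - h0) p | p <- B]; last exact: frame_mem.
  by rewrite mem_cat frameI.
- move=> a; have [//|C0 [B [RC0 CB Bn Ba]]] := cov_pair0 None (Some a).
  have [C zC] := mem_zip_unzip1 eq_size RC0.
  exists (cls (C0, C)), [seq hole p | p <- B], 0; split.
  + exact: map_f.
  + by rewrite mem_cat holeI ?orbT.
  + exact: (map_f hole Bn).
  + exact: (map_f hole Ba).
(* Pairs with equal second coordinates come from the hole, all others from the frame. *)
move=> a b d nab; have [d0|nd] := eqVneq d 0.
  rewrite {d}d0 in nab *; have [|C0 [B [RC0 CB Ba Bb]]] := cov_pair0 (Some a) (Some b).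
    by apply: contra nab => /eqP[->].
  have [C zC] := mem_zip_unzip1 eq_size RC0.
  exists (cls (C0, C)), [seq hole p | p <- B], 0; split.
  + exact: map_f.
  + by rewrite mem_cat holeI ?orbT.
  + exact: (map_f hole Ba).
  + by rewrite addr0; apply: (map_f hole Bb).
have [C [B [[h0 x] [FC CB Ba Bb]]]] := cov_pair (b - a) d nd.
have [C0 zC] := mem_zip_unzip2 eq_size FC.
exists (cls (C0, C)), [seq trans (a - h0) p | p <- B], x; split.
- exact: map_f.
- by rewrite mem_cat frameI.
- exact: frame_mem.
(* The translation taking [h0] to [a] takes [h0 + (b - a)] to [b]. *)
suff -> : a - h0 = b - (h0 + (b - a)) by apply: frame_mem.
by rewrite opprD opprB addrCA addrC [b + _]addrCA subrr addr0.
Qed.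

(** * Reduction to finite computations *)

Definition ords (n : nat) : seq 'I_n.+1 := [seq inZp i | i <- iota 0 n.+1].

Lemma mem_ords n (i : 'I_n.+1) : i \in ords n.
Proof. by apply/mapP; exists (i : nat); rewrite ?valZpK // mem_iota ltn_ord. Qed.

Definition pairs (A B : Type) (s : seq A) (t : seq B) : seq (A * B) :=
  [seq (x, y) | x <- s, y <- t].

Lemma mem_pairs (A B : eqType) (s : seq A) (t : seq B) :
  (forall x, x \in s) -> (forall y, y \in t) -> forall p, p \in pairs s t.
Proof. by move=> sP tP [x y]; apply/allpairsP; exists (x, y). Qed.

Definition differences (V : zmodType) (B : seq V) : seq V :=
  [seq q - p | p <- B, q <- B].

(** Filtering the differences by [d] first keeps the search for each [h] short. *)
Lemma frame_difference_family_check (k : nat) (H K : finZmodType)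
    (eH : seq H) (eK : seq K) (F : seq (seq (seq (H * K)))) :
    (forall h, h \in eH) -> (forall d, d \in eK) ->
    (size F * k.-1)%N = #|H| ->
    all (fun C => [&& (size C * k)%N == #|K|.-1, all (fun B => size B == k) C
      & all (fun d => (d == 0) || (d \in unzip2 (flatten C))) eK]) F ->
    (let D := flatten [seq differences B | B <- flatten F] in
      all (fun d => (d == 0) ||
        let Dd := unzip1 [seq p <- D | p.2 == d] in all [in Dd] eH) eK) ->
  frame_difference_family k F.
Proof.
move=> eHP eKP sizeF /allP/= FP /allP/= DP.
split=> // [C /FP/and3P[/eqP//]|C B /FP/and3P[_ /allP/= CP _] /CP/eqP//|C d|h d].
  move=> /FP/and3P[_ _ /allP/(_ _ (eKP d))/= + nd].
  rewrite (negPf nd) => /mapP[[h d'] /flattenP[B CB Bd] ->].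
  by exists B, h.
move=> nd; have := DP d (eKP d); rewrite (negPf nd) => /allP/(_ h (eHP h))/mapP.
case=> -[h' d']; rewrite mem_filter => /andP[/= /eqP-> Dp] ->.
move: Dp => /flattenP[_ /mapP[B /flattenP[C FC CB] ->]].
case/allpairsP=> -[p q] /= [Bp Bq eq_hd].
by exists C, B, p; rewrite eq_hd addrC subrK.
Qed.

(** The case of a single base class, where [#|A| = k - 1]; each difference is labelled by the two
    [A]-coordinates it joins. *)
Lemma resolved_cover_develop_check (k : nat) (A : finType) (K : finZmodType)
    (eA : seq A) (eK : seq K) (C : seq (seq (option (A * K)))) :
    (forall a, a \in eA) -> (forall d, d \in eK) -> k.-1 = #|A| ->
    (size C * k)%N = (#|A| * #|K|).+1 ->
    all (fun B => size B == k) C ->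
    all (fun x => x \in flatten C) (None :: map Some (pairs eA eK)) ->
    all (fun a => a \in
      unzip1 (flatten [seq pmap id B | B <- C & None \in B])) eA ->
    (let D := flatten [seq
         [seq ((p.1, q.1), q.2 - p.2) | p <- pmap id B, q <- pmap id B] | B <- C] in
      all (fun a => all (fun b => all (fun d =>
        ((a, 0) == (b, d)) || (((a, b), d) \in D)) eK) eA) eA) ->
  exists R, resolved_cover k (option (A * K)) R.
Proof.
move=> eAP eKP cardA sizeC /allP kC /allP covC /allP/= infC /allP/= DC.
eexists; apply: (@resolved_cover_develop k A K [:: C]) => [|D|D B|D x|a|a b d nab].
- by rewrite mul1n.
- by rewrite inE => /eqP->.
- by rewrite inE => /eqP-> /kC/eqP.
- rewrite inE => /eqP->; apply/flattenP; apply: covC; case: x => [x|] //.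
  by rewrite inE; apply/map_f/mem_pairs.
- have /mapP[[b x] /flattenP[_ /mapP[B + ->]]] := infC a (eAP a).
  rewrite mem_filter mem_pmap map_id => /andP[Bn CB] Bb /= ->.
  by exists C, B, x; rewrite inE.
have := DC a (eAP a) => /allP/(_ b (eAP b))/= /allP/(_ d (eKP d))/=.
rewrite (negPf nab) => /flattenP[_ /mapP[B CB ->]].
case/allpairsP=> -[[a' x] [b' y]] /= [+ + [-> -> ->]].
rewrite !mem_pmap !map_id => Ba Bb.
by exists C, B, x; rewrite inE addrC subrK.
Qed.

(** * The designs on 64 and 120 points *)

(* Lines of AG(2,8) = GF(64) in the direction GF(8): None is 0, and Some (i, j)
   is the power of a primitive element whose exponent is i mod 7 and j mod 9. *)
Definition affine_plane_class : seq (seq (option ('Z_7 * 'Z_9))) := [::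
    [:: None; Some (0, 0); Some (1, 0); Some (2, 0);
        Some (3, 0); Some (4, 0); Some (5, 0); Some (6, 0)];
    [:: Some (0, 4); Some (0, 5); Some (1, 1); Some (1, 8);
        Some (3, 2); Some (3, 7); Some (6, 3); Some (6, 6)];
    [:: Some (0, 1); Some (0, 8); Some (2, 2); Some (2, 7);
        Some (5, 3); Some (5, 6); Some (6, 4); Some (6, 5)];
    [:: Some (0, 2); Some (0, 7); Some (3, 3); Some (3, 6);
        Some (4, 4); Some (4, 5); Some (5, 1); Some (5, 8)];
    [:: Some (1, 2); Some (1, 7); Some (4, 3); Some (4, 6);
        Some (5, 4); Some (5, 5); Some (6, 1); Some (6, 8)];
    [:: Some (1, 3); Some (1, 6); Some (2, 4); Some (2, 5);
        Some (3, 1); Some (3, 8); Some (5, 2); Some (5, 7)];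
    [:: Some (0, 3); Some (0, 6); Some (1, 4); Some (1, 5);
        Some (2, 1); Some (2, 8); Some (4, 2); Some (4, 7)];
    [:: Some (2, 3); Some (2, 6); Some (3, 4); Some (3, 5);
        Some (4, 1); Some (4, 8); Some (6, 2); Some (6, 7)]].

(* Lines in the direction GF(16) of AG(2,16) = GF(256), intersected with
   Denniston's maximal arc {w | Tr(w^17) = 0} of degree 8: None is 0, and
   Some (i, j) is s_i z^j, for the 7 nonzero s_i in GF(16) with Tr(s_i) = 0 and
   z of order 17. *)
Definition denniston_class : seq (seq (option ('Z_7 * 'Z_17))) := [::
    [:: None; Some (0, 0); Some (1, 0); Some (2, 0);
        Some (3, 0); Some (4, 0); Some (5, 0); Some (6, 0)];
    [:: Some (0, 6); Some (0, 11); Some (1, 3); Some (1, 14);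
        Some (4, 4); Some (4, 13); Some (5, 8); Some (5, 9)];
    [:: Some (0, 5); Some (0, 12); Some (1, 1); Some (1, 16);
        Some (2, 6); Some (2, 11); Some (6, 8); Some (6, 9)];
    [:: Some (0, 7); Some (0, 10); Some (2, 2); Some (2, 15);
        Some (3, 5); Some (3, 12); Some (4, 1); Some (4, 16)];
    [:: Some (0, 4); Some (0, 13); Some (3, 7); Some (3, 10);
        Some (5, 5); Some (5, 12); Some (6, 6); Some (6, 11)];
    [:: Some (0, 3); Some (0, 14); Some (3, 4); Some (3, 13);
        Some (5, 7); Some (5, 10); Some (6, 2); Some (6, 15)];
    [:: Some (0, 8); Some (0, 9); Some (1, 7); Some (1, 10);
        Some (4, 5); Some (4, 12); Some (5, 3); Some (5, 14)];
    [:: Some (0, 1); Some (0, 16); Some (1, 6); Some (1, 11);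
        Some (2, 3); Some (2, 14); Some (6, 7); Some (6, 10)];
    [:: Some (1, 5); Some (1, 12); Some (2, 1); Some (2, 16);
        Some (3, 3); Some (3, 14); Some (5, 4); Some (5, 13)];
    [:: Some (0, 2); Some (0, 15); Some (2, 5); Some (2, 12);
        Some (3, 6); Some (3, 11); Some (4, 3); Some (4, 14)];
    [:: Some (1, 8); Some (1, 9); Some (2, 7); Some (2, 10);
        Some (3, 2); Some (3, 15); Some (5, 6); Some (5, 11)];
    [:: Some (1, 2); Some (1, 15); Some (3, 1); Some (3, 16);
        Some (4, 6); Some (4, 11); Some (6, 4); Some (6, 13)];
    [:: Some (2, 8); Some (2, 9); Some (4, 2); Some (4, 15);
        Some (5, 1); Some (5, 16); Some (6, 3); Some (6, 14)];
    [:: Some (1, 4); Some (1, 13); Some (3, 8); Some (3, 9);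
        Some (4, 7); Some (4, 10); Some (6, 1); Some (6, 16)];
    [:: Some (2, 4); Some (2, 13); Some (4, 8); Some (4, 9);
        Some (5, 2); Some (5, 15); Some (6, 5); Some (6, 12)]].

(** Multiplication by an element of order 9 permutes the nine directions of AG(2,8) regularly, so
    one class develops into all. *)
Lemma affine_plane_resolved_cover :
  exists R, resolved_cover 8 (option ('Z_7 * 'Z_9)) R.
Proof.
apply: (@resolved_cover_develop_check 8 'Z_7 'Z_9 (ords 6) (ords 8) affine_plane_class).
- exact: mem_ords.
- exact: mem_ords.
- by rewrite card_ord.
- by rewrite !card_ord.
all: by vm_compute.
Qed.

(** Multiplication by [z] preserves the arc, as [z^17 = 1], and permutes the 17 directions
    cyclically. *)
Lemma denniston_resolved_cover :
  exists R, resolved_cover 8 (option ('Z_7 * 'Z_17)) R.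
Proof.
apply: (@resolved_cover_develop_check 8 'Z_7 'Z_17 (ords 6) (ords 16) denniston_class).
- exact: mem_ords.
- exact: mem_ords.
- by rewrite card_ord.
- by rewrite !card_ord.
all: by vm_compute.
Qed.

(** * The two frame difference families *)

Definition F25 : finZmodType := ('Z_5 * 'Z_5)%type.
Definition F25_elements : seq F25 := pairs (ords 4) (ords 4).

Lemma mem_F25_elements d : d \in F25_elements.
Proof. by apply: mem_pairs; apply: mem_ords. Qed.

(* Multiplication in F_25 by a cube root of unity, in the basis 1, x with
   x^2 = x - 2. *)
Definition omega (H : Type) (p : H * F25) : H * F25 :=
  (p.1, (p.2.1 + p.2.2, p.2.1 *+ 2 + p.2.2 *+ 3)).

(* [iota] has order 4, and [nu] is d |-> e d^5 for a primitive e in F_25, so that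
   [act] has order 8 and [act]^4 is (h, d) |-> (h, - d). With the multiplications by
   cube roots of unity, [nu] generates a group regular on F_25 \ {0}. The orbit of
   (h0, 1) under [act] is itself a base block. *)
Definition nearfield_family (H : finZmodType) (iota : H -> H) (nu : F25 -> F25)
    (h0 : H) (Bs : seq (seq (H * F25))) : seq (seq (seq (H * F25))) :=
  let act p : H * F25 := (iota p.1, nu p.2) in
  let triple B := [:: B; map (@omega H) B; map (@omega H) (map (@omega H) B)] in
  triple (traject act (h0, (1, 0)) 8) ::
  flatten [seq [seq triple B' | B' <- traject (map act) B 8] | B <- Bs].

(** [iota] needs an automorphism of order 4: ['Z_7 * 'Z_9] has none, while the square of ['Z_3] has
    [(a, b) |-> (- b, a)]. *)
Definition H63 : finZmodType := ('Z_7 * ('Z_3 * 'Z_3))%type.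

Definition family1576 : seq (seq (seq (H63 * F25))) :=
  nearfield_family (fun h : H63 => (h.1, (- h.2.2, h.2.1)) : H63)
    (fun d : F25 => (- (d.2 *+ 2), - d.1) : F25) (0, (1, 0)) [::
    [:: (0, (0, 0), (1, 0)); (1, (0, 0), (4, 2)); (2, (0, 2), (2, 3)); (3, (1, 0), (3, 2));
        (4, (0, 2), (3, 1)); (5, (2, 1), (2, 4)); (6, (1, 0), (1, 3)); (6, (2, 0), (4, 0))]].

Definition H119 : finZmodType := ('Z_7 * 'Z_17)%type.

Definition family2976 : seq (seq (seq (H119 * F25))) :=
  nearfield_family (fun h : H119 => (h.1, - (h.2 *+ 4)) : H119)
    (fun d : F25 => (- d.2, d.1 *+ 2) : F25) (0, 1) [::
    [:: (0, 0, (1, 0)); (1, 0, (4, 1)); (2, 14, (2, 2)); (4, 15, (3, 1));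
        (5, 0, (0, 2)); (5, 1, (1, 1)); (5, 10, (4, 2)); (6, 11, (3, 4))];
    [:: (0, 0, (1, 0)); (0, 16, (3, 4)); (2, 9, (2, 4)); (3, 10, (4, 1));
        (4, 14, (4, 4)); (5, 2, (1, 4)); (5, 12, (3, 2)); (6, 8, (4, 3))]].

Lemma family1576_frame : frame_difference_family 8 family1576.
Proof.
pose eH : seq H63 := pairs (ords 6) (pairs (ords 2) (ords 2)).
apply: (@frame_difference_family_check 8 H63 F25 eH F25_elements).
- by apply: mem_pairs; [|apply: mem_pairs]; apply: mem_ords.
- exact: mem_F25_elements.
- by rewrite !card_prod !card_ord.
- by rewrite card_prod !card_ord; vm_compute.
- by vm_compute.
Qed.

Lemma family2976_frame : frame_difference_family 8 family2976.
Proof.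
pose eH : seq H119 := pairs (ords 6) (ords 16).
apply: (@frame_difference_family_check 8 H119 F25 eH F25_elements).
- by apply: mem_pairs; apply: mem_ords.
- exact: mem_F25_elements.
- by rewrite !card_prod !card_ord.
- by rewrite card_prod !card_ord; vm_compute.
- by vm_compute.
Qed.

(** * Assembly of the two designs *)

Lemma RBIBD_fill (k : nat) (H K : finZmodType) (F : seq (seq (seq (H * K))))
    (V : finType) (R : seq (seq (seq V))) :
    (1 < k)%N -> frame_difference_family k F ->
    #|V| = #|H|.+1 -> resolved_cover k V R ->
  exists (W : finType) (A : seq {set W}), is_RBIBD (#|H| * #|K|).+1 k 1 A.
Proof.
move=> k_gt1 Ffdf cardV Rcov.
have [|R0 R0cov] := @resolved_cover_transport k V (option H) R _ Rcov.
  by rewrite card_option.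
have [R1 /(RBIBD_of_resolved_cover k_gt1)] := resolved_cover_fill k_gt1 Ffdf R0cov.
by rewrite card_option_prod; exists (option (H * K)).
Qed.

Local Close Scope ring_scope.

Theorem theorem2p6 :
  (exists (V : finType) (A : seq {set V}), is_RBIBD 1576 8 1 A) /\
  (exists (V : finType) (A : seq {set V}), is_RBIBD 2976 8 1 A).
Proof.
split.
  (* The orders are [63 * 25 + 1 = 1576] and [119 * 25 + 1 = 2976]. *)
  have [R Rcov] := affine_plane_resolved_cover.
  have := RBIBD_fill _ family1576_frame _ Rcov.
  by rewrite card_option !card_prod !card_ord; apply.
have [R Rcov] := denniston_resolved_cover.
have := RBIBD_fill _ family2976_frame _ Rcov.
by rewrite card_option !card_prod !card_ord; apply.
Qed.
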